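(* Let $\mathcal{K}_1=\{(UD)^k: k\ge 0\}$ and let $\mathcal{K}_2=\{(UD)^k:k\ge 1\}\cup\{(UD)^kUUC_2:k\ge 0\}$. Let $\mathcal{K}$ be the set consisting of the empty path, the paths of $\mathcal{K}_2$, and the paths of the form $\beta_1U^{k_1}C_{k_1}\beta_2U^{k_2}C_{k_2}\cdots\beta_rU^{k_r}C_{k_r}\beta_{r+1}$ where $r\ge 1$, $k_i\ge 2$ and $\beta_i\in\mathcal{K}_1$ for $1\le i\le r$, and $\beta_{r+1}\in\mathcal{K}_2$. The ordinary generating function $K(x)=\sum_{P\in\mathcal{K}}x^{|P|}$ of $\mathcal{K}$ with respect to the length is $$K(x)=\frac{x^4+x-1}{x^2+x-1},$$ and its series expansion is $$1+x^2+x^3+x^4+2x^5+3x^6+5x^7+8x^8+13x^9+21x^{10}+34x^{11}+O(x^{12}).$$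
   Context: Paths are lattice paths in the first quadrant ($y\ge 0$) starting at the origin and ending on the $x$-axis, written as words in the steps $U=(1,1)$, $D=(1,-1)$ and catastrophe steps $C_k=(1,-k)$, $k\ge 2$, where a catastrophe step must end on the $x$-axis (so $C_k$ can only be used from height $k$); these are called Dyck paths with catastrophes. The length $|P|$ is the number of steps of $P$; the empty path has length $0$. Generating functions are formal power series in $x$. *)

(* Defs.v *)
From HB Require Import structures.
From mathcomp Require Import all_boot all_order all_algebra.
From mathcomp Require Import finmap zify.
From mathcomp Require Import all_classical.

Set Implicit Arguments.
Unset Strict Implicit.
Unset Printing Implicit Defensive.

Import GRing.Theory.

Record fps (R : Type) := Fps { fcoef : nat -> R }.

HB.instance Definition _ (R : Type) := gen_eqMixin (fps R).
HB.instance Definition _ (R : Type) := gen_choiceMixin (fps R).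

Section FpsRing.
Local Open Scope ring_scope.
Variable R : comNzRingType.
Implicit Types f g h : fps R.

Lemma fpsP f g : (forall n, fcoef f n = fcoef g n) -> f = g.
Proof. by case: f g => [f] [g] /= fg; congr Fps; apply/funext. Qed.

Definition fps0 : fps R := Fps (fun=> 0).
Definition fps1 : fps R := Fps (fun n => (n == 0%N)%:R).
Definition fpsX : fps R := Fps (fun n => (n == 1%N)%:R).
Definition fps_opp f : fps R := Fps (fun n => - fcoef f n).
Definition fps_add f g : fps R := Fps (fun n => fcoef f n + fcoef g n).
Definition fps_mul f g : fps R :=
  Fps (fun n => \sum_(i < n.+1) fcoef f i * fcoef g (n - i)%N).

Fact fps_addA : associative fps_add.
Proof. by move=> f g h; apply: fpsP => n /=; rewrite addrA. Qed.
Fact fps_addC : commutative fps_add.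
Proof. by move=> f g; apply: fpsP => n /=; rewrite addrC. Qed.
Fact fps_add0 : left_id fps0 fps_add.
Proof. by move=> f; apply: fpsP => n /=; rewrite add0r. Qed.
Fact fps_addN : left_inverse fps0 fps_opp fps_add.
Proof. by move=> f; apply: fpsP => n /=; rewrite addNr. Qed.

HB.instance Definition _ :=
  GRing.isZmodule.Build (fps R) fps_addA fps_addC fps_add0 fps_addN.

Let trunc n f : {poly R} := \poly_(i < n) fcoef f i.

Let mul_trunc n N f g : (n < N)%N ->
  fcoef (fps_mul f g) n = (trunc N f * trunc N g)`_n.
Proof.
move=> nN; rewrite coefM; apply: eq_bigr => -[i /= iN] _; rewrite !coef_poly.
by rewrite (leq_ltn_trans (leq_subr _ _) nN) (leq_ltn_trans _ nN).
Qed.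

Fact fps_mulC : commutative fps_mul.
Proof.
by move=> f g; apply: fpsP => n; rewrite !(mul_trunc _ _ (ltnSn n)) mulrC.
Qed.

Fact fps_mulA : associative fps_mul.
Proof.
move=> f g h; apply: fpsP => n.
have -> : fcoef (fps_mul f (fps_mul g h)) n
  = (trunc n.+1 f * (trunc n.+1 g * trunc n.+1 h))`_n.
  rewrite coefM; apply: eq_bigr => -[i /= iN] _.
  by rewrite coef_poly iN -(mul_trunc g h) // ltnS leq_subr.
have -> : fcoef (fps_mul (fps_mul f g) h) n
  = ((trunc n.+1 f * trunc n.+1 g) * trunc n.+1 h)`_n.
  rewrite coefM; apply: eq_bigr => -[i /= iN] _.
  by rewrite coef_poly ltnS leq_subr -(mul_trunc f g).
by rewrite mulrA.
Qed.

Fact fps_mul1 : left_id fps1 fps_mul.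
Proof.
move=> f; apply: fpsP => n /=.
rewrite big_ord_recl /= subn0 mul1r big1 ?addr0 // => i _.
by rewrite mul0r.
Qed.

Fact fps_mulDl : left_distributive fps_mul fps_add.
Proof.
move=> f g h; apply: fpsP => n /=.
by rewrite -big_split; apply: eq_bigr => i _; rewrite mulrDl.
Qed.

Fact fps_one_neq0 : fps1 != 0.
Proof.
apply/eqP => /(congr1 (fun f => fcoef f 0)) /= /eqP.
by rewrite (oner_eq0 R).
Qed.

HB.instance Definition _ := GRing.Zmodule_isComNzRing.Build (fps R)
  fps_mulA fps_mulC fps_mul1 fps_mulDl fps_one_neq0.

Lemma fcoef0 n : fcoef (0 : fps R) n = 0. Proof. by []. Qed.
Lemma fcoef1 n : fcoef (1 : fps R) n = (n == 0%N)%:R. Proof. by []. Qed.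
Lemma fcoefN f n : fcoef (- f) n = - fcoef f n. Proof. by []. Qed.
Lemma fcoefD f g n : fcoef (f + g) n = fcoef f n + fcoef g n.
Proof. by []. Qed.
Lemma fcoefM f g n :
  fcoef (f * g) n = \sum_(i < n.+1) fcoef f i * fcoef g (n - i)%N.
Proof. by []. Qed.

Lemma fcoefXn k n : fcoef (fpsX ^+ k) n = (n == k)%:R.
Proof.
elim: k n => [|k IHk] n; first by rewrite expr0.
rewrite exprS fcoefM; case: n => [|n].
  by rewrite big_ord1 /= mul0r.
rewrite big_ord_recl /= mul0r add0r big_ord_recl /= mul1r subSS subn0 IHk.
by rewrite big1 ?addr0 // => i _; rewrite mul0r.
Qed.

End FpsRing.

Arguments fpsX {R}.

Section FpsUnitRing.
Local Open Scope ring_scope.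
Variable R : comUnitRingType.
Implicit Types f g : fps R.

(* The list of the first n.+1 coefficients of 1/f, from the recursion
   f_0 g_n = - \sum_(i < n) f_(n-i) g_i. *)
Fixpoint inv_coefs f n : seq R :=
  if n is m.+1 then
    let s := inv_coefs f m in
    rcons s (- ((fcoef f 0)^-1 * \sum_(i < n) fcoef f (n - i)%N * s`_i))
  else [:: (fcoef f 0)^-1].

Definition fps_unit : {pred fps R} :=
  [pred f | fcoef f 0 \is a GRing.unit].

Definition fps_inv f : fps R :=
  if f \in fps_unit then Fps (fun n => (inv_coefs f n)`_n) else f.

Let size_inv_coefs f n : size (inv_coefs f n) = n.+1.
Proof. by elim: n => //= n IHn; rewrite size_rcons IHn. Qed.

Let nth_inv_coefs f n i : (i <= n)%N ->
  (inv_coefs f n)`_i = (inv_coefs f i)`_i.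
Proof.
elim: n => [|n IHn]; first by case: i.
rewrite leq_eqVlt => /predU1P[->//|]; rewrite ltnS => le_in.
by rewrite [LHS]/= nth_rcons size_inv_coefs ltnS le_in IHn.
Qed.

Fact fps_mulVf : {in fps_unit, left_inverse 1 fps_inv *%R}.
Proof.
move=> f f0; rewrite /fps_inv f0; rewrite inE in f0.
rewrite mulrC; apply: fpsP => -[|n]; rewrite fcoefM fcoef1.
  by rewrite big_ord1 /= divrr.
rewrite big_ord_recl subn0 [X in _ * X]/= nth_rcons size_inv_coefs ltnn eqxx.
rewrite mulrN mulrA divrr // mul1r; apply/eqP; rewrite addrC subr_eq0; apply/eqP.
rewrite (reindex_inj rev_ord_inj); apply: eq_bigr => -[i /= lt_in] _.
have e : bump 0 (n.+1 - i.+1) = (n.+1 - i)%N by rewrite /bump; lia.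
rewrite e; have -> : (n.+1 - (n.+1 - i) = i)%N by lia.
by rewrite (@nth_inv_coefs _ n).
Qed.

Fact fps_unitPl f g : g * f = 1 -> fps_unit f.
Proof.
move=> /(congr1 (fun h => fcoef h 0)); rewrite fcoefM big_ord1 fcoef1 /= => gf1.
by apply/unitrPr; exists (fcoef g 0); rewrite mulrC.
Qed.

Fact fps_inv_out : {in [predC fps_unit], fps_inv =1 id}.
Proof. by move=> f; rewrite inE /= /fps_inv => /negbTE->. Qed.

HB.instance Definition _ := GRing.ComNzRing_hasMulInverse.Build (fps R)
  fps_mulVf fps_unitPl fps_inv_out.

Lemma fps_unitE f : (f \is a GRing.unit) = (fcoef f 0 \is a GRing.unit).
Proof. by []. Qed.

End FpsUnitRing.

(* [Cat k] is the catastrophe step C_k = (1, -k); the side condition k >= 2 is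
   part of [is_dyck_cat]. *)
Inductive step := U | D | Cat of nat.

Definition nat_of_step s := match s with U => 0 | D => 1 | Cat k => k.+2 end.
Definition step_of_nat n :=
  match n with 0 => U | 1 => D | k.+2 => Cat k end.
Fact nat_of_stepK : cancel nat_of_step step_of_nat.
Proof. by case. Qed.
HB.instance Definition _ := Countable.copy step (can_type nat_of_stepK).

Definition lpath := seq step.

(* [dyck_cat_from h P]: P, started at height h, stays weakly above the x-axis,
   ends on it, and uses C_k only with k >= 2 and from height k. *)
Fixpoint dyck_cat_from (h : nat) (P : lpath) : bool :=
  match P with
  | [::] => h == 0
  | U :: P' => dyck_cat_from h.+1 P'
  | D :: P' => (0 < h) && dyck_cat_from h.-1 P'
  | Cat k :: P' => [&& 2 <= k, h == k & dyck_cat_from 0 P']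
  end.

Definition is_dyck_cat (P : lpath) := dyck_cat_from 0 P.

Definition UD_pow (k : nat) : lpath := flatten (nseq k [:: U; D]).
Definition U_pow (k : nat) : lpath := nseq k U.

Local Open Scope classical_set_scope.

Definition K1 : set lpath := [set P | exists k, P = UD_pow k].

Definition K2 : set lpath :=
  [set P | exists2 k, 1 <= k & P = UD_pow k] `|`
  [set P | exists k, P = UD_pow k ++ [:: U; U; Cat 2]].

(* Only the values beta 1, ..., beta r.+1 and k 1, ..., k r matter. *)
Definition Kcat : set lpath :=
  [set P | exists (r : nat) (beta : nat -> lpath) (k : nat -> nat),
    [/\ 1 <= r,
        forall i, 1 <= i <= r -> 2 <= k i /\ K1 (beta i),
        K2 (beta r.+1) &
        P = \big[cat/[::]]_(1 <= i < r.+1)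
              (beta i ++ U_pow (k i) ++ [:: Cat (k i)]) ++ beta r.+1]].

Definition K : set lpath := [set [::]] `|` K2 `|` Kcat.

Definition of_length (A : set lpath) (n : nat) : set lpath :=
  [set P | A P /\ size P = n].

(* [fset_set] sends infinite sets to the empty set; this is harmless for sets
   of Dyck paths with catastrophes, see [dyck_cat_finite]. *)
Definition ogf (A : set lpath) : fps int :=
  Fps (fun n => Posz #|` fset_set (of_length A n)|).

Lemma dyck_cat_from_bound h P : dyck_cat_from h P ->
  all (fun s => nat_of_step s <= h + size P + 1) P.
Proof.
elim: P h => //= -[||k] P IHP h.
- by move=> /IHP AP; apply: sub_all AP => s /=; lia.
- move=> /andP[h0 /IHP AP]; apply/andP; split; first by rewrite /=; lia.
  by apply: sub_all AP => s /=; lia.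
- move=> /and3P[k2 /eqP -> /IHP AP]; apply/andP; split; first by rewrite /=; lia.
  by apply: sub_all AP => s /=; lia.
Qed.

Lemma dyck_cat_finite (A : set lpath) n :
  A `<=` is_dyck_cat -> finite_set (of_length A n).
Proof.
move=> Adyck.
pose F (t : n.-tuple 'I_(n + 3)) : lpath :=
  [seq step_of_nat (val i) | i <- t].
apply: (@sub_finite_set _ _ (F @` setT)); last first.
  exact/finite_image/finite_finset.
move=> P [/Adyck /dyck_cat_from_bound Pb Pn].
have Pb' : all (fun m => m < n + 3) [seq nat_of_step s | s <- P].
  by rewrite all_map; apply: sub_all Pb => s /=; rewrite Pn; lia.
have sz : size [seq (inord (nat_of_step s) : 'I_(n + 2).+1) | s <- P] == n.
  by rewrite size_map Pn.
pose t : n.-tuple 'I_(n + 2).+1 := Tuple sz.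
have e : (n + 2).+1 = n + 3 by lia.
exists (map_tuple (cast_ord e) t) => //.
rewrite /F /= -!map_comp -[RHS]map_id; apply/eq_in_map => s sP /=.
rewrite inordK ?nat_of_stepK //.
by rewrite e; move/allP: Pb' => /(_ (nat_of_step s)); apply; apply: map_f.
Qed.

Lemma ogf_denom_unit :
  ((fpsX ^+ 2 + fpsX - 1)%R : fps int) \is a GRing.unit.
Proof. by rewrite fps_unitE !fcoefD fcoefN fcoefXn fcoef1. Qed.

Lemma K_dyck_cat : K `<=` is_dyck_cat.
Proof.
have UDP h k Q : dyck_cat_from h (UD_pow k ++ Q) = dyck_cat_from h Q.
  by elim: k => //= k IHk; rewrite /UD_pow /= -/(UD_pow k) IHk.
have UP h k Q : dyck_cat_from h (U_pow k ++ Q) = dyck_cat_from (h + k) Q.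
  elim: k h => [|k IHk] h /=; first by rewrite addn0.
  by rewrite IHk addSnnS.
have K2P : K2 `<=` is_dyck_cat.
  move=> P [[k _ ->]|[k ->]]; rewrite /is_dyck_cat ?UDP //.
  by rewrite -[UD_pow k]cats0 UDP.
move=> P [[->//|/K2P//]|[r [beta [k [_ bk /K2P bP ->]]]]].
rewrite /is_dyck_cat.
have: {in index_iota 1 r.+1, forall i, 2 <= k i /\ K1 (beta i)}.
  by move=> i; rewrite mem_index_iota ltnS; apply: bk.
elim: (index_iota 1 r.+1) => [|i s IHs] sk; first by rewrite big_nil.
have [ki [m bi]] := sk i (mem_head i s).
rewrite big_cons -!catA bi UDP UP /= add0n ki eqxx /=; apply: IHs => j js.
by apply: sk; rewrite inE js orbT.
Qed.

(* Main.v *)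
Require Import Defs.
From mathcomp Require Import all_boot all_order all_algebra.
From mathcomp Require Import finmap.
From mathcomp Require Import all_classical.
From mathcomp Require Import zify ring.
Import GRing.Theory.
Local Open Scope ring_scope.

(** Cutting a path of K after each return to the axis writes it uniquely as a
    word in the blocks UD and U^k C_k (k >= 2), one block for each length at
    least 2; the condition on the last factor beta_(r+1) says exactly that the
    last block is UD or UUC_2.  Hence K(x) = 1 + (x^2 + x^3) C(x), where C counts
    compositions into parts at least 2.  Such a composition of n + 2 either
    starts with a part 2 or has a first part that can be decreased, so
    C = 1 + x^2 C + x (C - 1). *)

(* Parts are shifted by 2: the entry [j] stands for the block of length [j + 2]. *)
Definition block (j : nat) : lpath :=
  U_pow j.+1 ++ [:: if j is 0 then D else Cat j.+1].

Definition word (s : seq nat) : lpath := flatten (map block s).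

Definition weight (s : seq nat) : nat := sumn [seq j.+2 | j <- s].

(** * Words in the blocks: length and unique decomposition *)

Lemma word_cons j s : word (j :: s) = block j ++ word s.
Proof. by []. Qed.

Lemma size_word s : size (word s) = weight s.
Proof.
elim: s => // j s IHs.
by rewrite word_cons size_cat IHs size_cat size_nseq /= addn1.
Qed.

Lemma weight_rcons s l : weight (rcons s l) = (weight s + l.+2)%N.
Proof. by rewrite /weight map_rcons sumn_rcons. Qed.

(** The initial run of up steps determines the first block, so a word can be decoded block by
    block. *)
Lemma find_block j s : find (predC1 U) (word (j :: s)) = j.+1.
Proof.
rewrite word_cons -catA find_cat has_nseq /= size_nseq.
by case: j => [|j]; rewrite /= addn0.
Qed.

Lemma word_inj : injective word.
Proof.
elim=> [|i s IHs] [|j t] //.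
move=> e; have := congr1 (find (predC1 U)) e; rewrite !find_block => -[ij].
move: e; rewrite ij !word_cons => /eqP.
by rewrite eqseq_cat // => /andP[_ /eqP /IHs ->].
Qed.

(** * The nonempty paths of [K] as words with last block UD or UUC_2 *)

Lemma UD_pow_word k : UD_pow k = word (nseq k 0%N).
Proof. by rewrite /word map_nseq. Qed.

Lemma word_cat s t : word (s ++ t) = word s ++ word t.
Proof. by rewrite /word map_cat flatten_cat. Qed.

Lemma block_Cat k : (2 <= k)%N -> U_pow k ++ [:: Cat k] = block k.-1.
Proof. by case: k => [|[|k]]. Qed.

Lemma K2_word P : K2 P -> exists s l, (l <= 1)%N /\ P = word (rcons s l).
Proof.
move=> [[[//|k] _ ->]|[k ->]].
  exists (nseq k 0%N), 0%N; split=> //.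
  by rewrite UD_pow_word -addn1 nseqD cats1.
by exists (nseq k 0%N), 1%N; rewrite -cats1 word_cat UD_pow_word.
Qed.

Lemma Kcat_word P : Kcat P -> exists s l, (l <= 1)%N /\ P = word (rcons s l).
Proof.
move=> [r [beta [k [_ bk /K2_word [s0 [l [l1 ->]]] ->]]]].
(* Restating the hypothesis over a list of indices lets the induction peel off the first factor
   while the last one stays fixed. *)
have: {in index_iota 1 r.+1, forall i, (2 <= k i)%N /\ K1 (beta i)}.
  by move=> i; rewrite mem_index_iota ltnS; apply: bk.
elim: (index_iota 1 r.+1) => [|i t IHt] kb.
  by exists s0, l; rewrite big_nil.
have [ki [m bi]] := kb i (mem_head i t).
have [|s [l' [l'1 e]]] := IHt.
  by move=> j jt; apply: kb; rewrite inE jt orbT.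
exists (nseq m 0%N ++ (k i).-1 :: s), l'; split=> //.
rewrite big_cons -catA e bi rcons_cat word_cat -UD_pow_word.
by rewrite rcons_cons word_cons -catA block_Cat.
Qed.

Lemma Kcat_cons b k Q : K1 b -> (2 <= k)%N -> K2 Q \/ Kcat Q ->
  Kcat (b ++ U_pow k ++ [:: Cat k] ++ Q).
Proof.
move=> b1 k2 [Q2|[r [beta [kk [r1 bk bQ ->]]]]].
  exists 1%N, (fun i => if i == 1%N then b else Q), (fun=> k); split=> //.
    by move=> [|[|i]].
  by rewrite big_nat1 /= -!catA.
(* The new factor takes index 1 and the old ones move up by one; index 0 is never read. *)
exists r.+1, (fun i => if (i <= 1)%N then b else beta i.-1),
  (fun i => if (i <= 1)%N then k else kk i.-1); split=> //.
- by move=> [|[|i]] //= ir; apply: bk.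
- rewrite [in RHS]big_ltn // [in RHS]big_add1 /= -!catA; congr (_ ++ (_ ++ _ :: _ ++ _)).
  by apply: eq_big_nat => -[].
Qed.

(** The prefix [UD_pow m] strengthens the induction: it accumulates leading blocks UD until a
    catastrophe block closes the current factor. *)
Lemma word_K s l m : (l <= 1)%N ->
  let P := UD_pow m ++ word (rcons s l) in K2 P \/ Kcat P.
Proof.
move=> l1; elim: s m => [|[|j] s IHs] m.
- left; case: l l1 => [|[|//]] _; last by right; exists m.
  left; exists m.+1 => //.
  by rewrite !UD_pow_word -word_cat -addn1 nseqD.
- have -> : UD_pow m ++ word (rcons (0%N :: s) l)
      = UD_pow m.+1 ++ word (rcons s l).
    by rewrite !UD_pow_word -!word_cat -addn1 nseqD -catA.
  exact: IHs.
- right; rewrite rcons_cons word_cons -[j.+1]/(j.+2.-1) -block_Cat // -catA.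
  by apply: Kcat_cons; [exists m | | apply: (IHs 0%N)].
Qed.

Lemma K_wordP P : K P <->
  P = [::] \/ exists s l, (l <= 1)%N /\ P = word (rcons s l).
Proof.
split=> [[[->|/K2_word]|/Kcat_word]|[->|[s [l [l1 ->]]]]].
- by left.
- by right.
- by right.
- by left; left.
- by have [] := word_K s l 0%N l1 => ?; [left; right | right].
Qed.

(** * Enumeration of compositions into parts at least 2 *)

(** The default of [head] is never met below: [comps] applies this map only to lists of positive
    weight. *)
Definition incr_head (s : seq nat) : seq nat := (head 0 s).+1 :: behead s.

Fixpoint comps (n : nat) : seq (seq nat) :=
  match n with
  | 0 => [:: [::]]
  | 1 => [::]
  | (m.+1 as k).+1 => map (cons 0%N) (comps m) ++ map incr_head (comps k)
  end.

Lemma compsSS n :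
  comps n.+2 = map (cons 0%N) (comps n) ++ map incr_head (comps n.+1).
Proof. by []. Qed.

Lemma mem_comps n s : (s \in comps n) = (weight s == n).
Proof.
have [m] := ubnP n; elim: m n s => // m IHm [|[|n]] s nm.
- by case: s.
- by case: s => [|j s] //=; rewrite /weight.
rewrite compsSS mem_cat; apply/orP/eqP => [[]/mapP[t]|].
- by rewrite IHm; [move=> /eqP <- -> | lia].
- rewrite IHm // => /eqP; case: t => // j t wt ->.
  by move: wt; rewrite /weight /=; lia.
- case: s => // -[|j] s; rewrite /weight /= => ws.
    left; apply/mapP; exists s => //; rewrite IHm; last by lia.
    by apply/eqP; rewrite /weight; lia.
  right; apply/mapP; exists (j :: s) => //; rewrite -/(comps n.+1) IHm; last by lia.
  by apply/eqP; rewrite /weight /=; lia.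
Qed.

Lemma uniq_comps n : uniq (comps n).
Proof.
have [m] := ubnP n; elim: m n => // m IHm [|[|n]] // nm.
rewrite compsSS cat_uniq map_inj_uniq ?IHm //; [|by lia|by move=> ? ? []].
rewrite map_inj_in_uniq ?IHm ?andbT //.
  by apply/hasPn => s /mapP[t _ ->]; apply/negP => /mapP[].
(* [incr_head] identifies [[::]] with [[:: 0]]; positive weight rules out the empty list. *)
move=> s t; rewrite !mem_comps.
by case: s => // i s; case: t => // j t _ _ [-> ->].
Qed.

(** * Counting the paths of [K] of given length *)

(** The last block has length 2 or 3. The guards exclude truncated subtractions, which would yield
    spurious words from [comps 0]. *)
Definition Kwords (n : nat) : seq (seq nat) :=
  (if n == 0 then [:: [::]] else [::]) ++
  ((if (n < 2)%N then [::] else [seq rcons s 0%N | s <- comps (n - 2)]) ++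
   (if (n < 3)%N then [::] else [seq rcons s 1%N | s <- comps (n - 3)])).

Lemma uniq_Kwords n : uniq (Kwords n).
Proof.
have rcons_uniq l k : uniq [seq rcons s l | s <- comps k].
  by rewrite map_inj_uniq ?uniq_comps //; apply: rcons_injl.
rewrite /Kwords; case: n => [|[|[|n]]] //.
rewrite [_ == _]/= cat0s cat_uniq !rcons_uniq andbT /=.
apply/hasPn => _ /mapP[s _ ->]; apply/negP => /mapP[t _ /eqP].
by rewrite eqseq_rcons andbF.
Qed.

Lemma of_length_K n :
  of_length K n = [set P | P \in map word (Kwords n)]%classic.
Proof.
apply/seteqP; split=> [P [/K_wordP KP <-]|P /= /mapP[t tn ->]].
  apply/mapP; case: KP => [->|[s [l [l1 ->]]]]; first by exists [::].
  exists (rcons s l) => //.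
  rewrite size_word weight_rcons !mem_cat; apply/orP; right; apply/orP.
  case: l l1 => [|[|//]] _; [left|right].
    rewrite ifF ?addnK; last by lia.
    by apply: (map_f (rcons^~ 0%N)); rewrite mem_comps.
  rewrite ifF ?addnK; last by lia.
  by apply: (map_f (rcons^~ 1%N)); rewrite mem_comps.
split.
  apply/K_wordP; move: tn; rewrite !mem_cat => /or3P[].
  - by case: ifP => // _; rewrite inE => /eqP ->; left.
  - by case: ifP => // _ /mapP[s _ ->]; right; exists s, 0%N.
  - by case: ifP => // _ /mapP[s _ ->]; right; exists s, 1%N.
rewrite size_word; move: tn; rewrite !mem_cat => /or3P[].
- by case: ifP => // /eqP ->; rewrite inE => /eqP ->.
- case: ifP => // n2 /mapP[s]; rewrite mem_comps => /eqP ws ->.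
  by rewrite weight_rcons; lia.
- case: ifP => // n3 /mapP[s]; rewrite mem_comps => /eqP ws ->.
  by rewrite weight_rcons; lia.
Qed.

Lemma card_of_length_K n : #|` fset_set (of_length K n)| = size (Kwords n).
Proof.
have -> : of_length K n = [set` [fset P in map word (Kwords n)]%fset]%classic.
  by rewrite of_length_K; apply/seteqP; split=> P /=; rewrite inE.
rewrite set_fsetK card_fseq undup_id ?size_map //.
by rewrite map_inj_uniq ?uniq_Kwords //; apply: word_inj.
Qed.

(** * Generating functions *)

Lemma fcoefXnM (R : comNzRingType) k (f : fps R) n :
  fcoef (fpsX ^+ k * f) n = if (n < k)%N then 0 else fcoef f (n - k).
Proof.
rewrite fcoefM; case: ltnP => [nk|kn].
  rewrite big1 // => i _; rewrite fcoefXn ltn_eqF; first exact: mul0r.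
  exact: leq_trans (ltn_ord i) nk.
have kn' : (k < n.+1)%N by [].
rewrite (bigD1 (Ordinal kn')) //= fcoefXn eqxx mul1r big1 ?addr0 // => i ik.
by rewrite fcoefXn -[_ == k]/(i == Ordinal kn') (negbTE ik) mul0r.
Qed.

Definition comps_gf : fps int := Fps (fun n => Posz (size (comps n))).

Lemma comps_gfE : comps_gf * (1 - fpsX - fpsX ^+ 2) = 1 - fpsX.
Proof.
(* Writing [fpsX] as a first power lets [fcoefXnM] handle both shifts; what remains is the recursion
   of [comps]. *)
have -> : comps_gf * (1 - fpsX - fpsX ^+ 2)
    = comps_gf - fpsX ^+ 1 * comps_gf - fpsX ^+ 2 * comps_gf by ring.
apply: fpsP => n; rewrite !(fcoefD, fcoefN, fcoefXnM) fcoef1 /=.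
case: n => [|[|n]] //.
by rewrite compsSS size_cat !size_map !subSS !subn0 /=; lia.
Qed.

Lemma ogf_K : ogf K = 1 + (fpsX ^+ 2 + fpsX ^+ 3) * comps_gf.
Proof.
apply: fpsP => n; rewrite mulrDl !fcoefD !fcoefXnM fcoef1 /= card_of_length_K.
rewrite /Kwords !size_cat.
by case: n => [|[|[|n]]] //=; rewrite !size_map.
Qed.

Theorem theorem3p10 :
  let x : fps int := fpsX in
  ogf K = (x ^+ 4 + x - 1) / (x ^+ 2 + x - 1) /\
  exists R : fps int,
    ogf K = 1 + x ^+ 2 + x ^+ 3 + x ^+ 4 + 2 * x ^+ 5 + 3 * x ^+ 6
      + 5 * x ^+ 7 + 8 * x ^+ 8 + 13 * x ^+ 9 + 21 * x ^+ 10
      + 34 * x ^+ 11 + x ^+ 12 * R.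
Proof.
move=> x; have Dunit := ogf_denom_unit; rewrite -/x in Dunit.
have KE : ogf K * (x ^+ 2 + x - 1) = x ^+ 4 + x - 1.
  rewrite ogf_K -/x.
  have -> : (1 + (x ^+ 2 + x ^+ 3) * comps_gf) * (x ^+ 2 + x - 1)
      = x ^+ 2 + x - 1
        - (x ^+ 2 + x ^+ 3) * (comps_gf * (1 - x - x ^+ 2)) by ring.
  by rewrite comps_gfE -/x; ring.
split; first by rewrite -KE mulrK.
(* The coefficients from x^12 on continue the Fibonacci recursion with 55 and 89 = 55 + 34, so this
   tail divided by x^12 and multiplied by 1 - x - x^2 is 55 + 34x. *)
exists (- (55 + 34 * x) / (x ^+ 2 + x - 1)).
apply: (mulIr Dunit); rewrite KE mulrDl -[_ * _ * (_ - 1)]mulrA divrK //.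
by ring.
Qed.
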